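(* Let $G$ be a locally compact group and let $P\subset G$ be a closed subsemigroup containing the identity such that $G=PP^{-1}$ and the interior $\mathrm{Int}(P)$ of $P$ in $G$ is dense in $P$. Let $X$ be a compact space with an injective right action of $P$, and let $\mathcal{G}=X\rtimes P$ be the associated semi-direct product groupoid. The following are equivalent. (1) The groupoid $\mathcal{G}$ has a left Haar system. (2) The map $X\times \mathrm{Int}(P)\to X$, $(x,a)\mapsto xa$, is open. (3) If $U\subset \mathrm{Int}(P)$ is open, then $XU=\{xu: x\in X, u\in U\}$ is open in $X$. (4) For every $a\in P$, the set $X\,\mathrm{Int}(P)\,a=\{xpa: x\in X, p\in \mathrm{Int}(P)\}$ is open in $X$. (5) The measures $(\lambda^{x})_{x\in X}$ form a left Haar system on $\mathcal{G}$.
   Context: All topological spaces are Hausdorff and second countable. A right action of $P$ on $X$ is a continuous map $X\times P\to X$, $(x,a)\mapsto xa$, with $xe=x$ and $(xa)b=x(ab)$; it is injective if $x\mapsto xa$ is injective for every $a\in P$. The semi-direct product groupoid is $$\mathcal{G}=X\rtimes P=\{(x,g)\in X\times G:\ \exists\, a,b\in P,\ y\in X \text{ with } g=ab^{-1},\ xa=yb\}.$$ It is a closed subset of $X\times G$ and carries the subspace topology. For $(x,g)\in\mathcal{G}$, $s(x,g)$ denotes the unique $y\in X$ such that $xa=yb$ whenever $g=ab^{-1}$ with $a,b\in P$; the range is $r(x,g)=x$. The product is $(x,g)(y,h)=(x,gh)$ when $y=s(x,g)$, and $(x,g)^{-1}=(s(x,g),g^{-1})$. With these operations $\mathcal{G}$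 is a locally compact Hausdorff topological groupoid with unit space identified with $X$. For $x\in X$ let $Q_x=\{g\in G:(x,g)\in\mathcal{G}\}$, so $\mathcal{G}^x:=r^{-1}(x)=\{x\}\times Q_x$. The measure $\lambda^x$ on $\mathcal{G}$ is defined by $\int f\,d\lambda^x=\int f(x,g)1_{Q_x}(g)\,dg$ for $f\in C_c(\mathcal{G})$, where $dg$ is a left Haar measure on $G$. A left Haar system on $\mathcal{G}$ is a family $(\nu^x)_{x\in X}$ of Radon measures on $\mathcal{G}$ such that $\mathrm{supp}(\nu^x)=\mathcal{G}^x$ for each $x$, $x\mapsto\int f\,d\nu^x$ is continuous for every $f\in C_c(\mathcal{G})$, and $\int f(\gamma\eta)\,d\nu^{s(\gamma)}(\eta)=\int f(\eta)\,d\nu^{r(\gamma)}(\eta)$ for all $\gamma\in\mathcal{G}$ and $f\in C_c(\mathcal{G})$. *)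

(* Defs.v *)
From HB Require Import structures.
From mathcomp Require Import all_boot all_order all_algebra.
From mathcomp Require Import all_classical all_reals all_analysis.

Set Implicit Arguments.
Unset Strict Implicit.
Unset Printing Implicit Defensive.

Import Order.TTheory GRing.Theory Num.Theory.
Import numFieldNormedType.Exports.

Local Open Scope classical_set_scope.
Local Open Scope ring_scope.

HB.structure Definition PreTopologicalGroup := {G of Topological G & Group G}.

HB.mixin Record PreTopologicalGroup_isTopologicalGroup G
    & PreTopologicalGroup G := {
  mulg_continuous : continuous (fun p : G * G => (p.1 * p.2)%g) ;
  invg_continuous : continuous (fun g : G => (g^-1)%g)
}.

#[short(type="topologicalGroupType")]
HB.structure Definition TopologicalGroup :=
  {G of PreTopologicalGroup G & PreTopologicalGroup_isTopologicalGroup G}.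

(* Measurable types are pointed in the library. The distinguished point is an
   explicit argument here, so that empty spaces need not be excluded: a family
   of measures indexed by a possibly empty set picks a point for each index. *)
Definition pointed_at (T : topologicalType) (t : T) : Type := T.

HB.instance Definition _ (T : topologicalType) (t : T) :=
  Topological.copy (pointed_at t) T.
HB.instance Definition _ (T : topologicalType) (t : T) :=
  isPointed.Build (pointed_at t) t.

Notation borel t := (g_sigma_algebraType (@open (pointed_at t))).
Notation borel_measure R t := {measure set (borel t) -> \bar R}.

Section borel_measures.
Context {R : realType} {T : topologicalType} {t : T}.
Implicit Type mu : borel_measure R t.
Local Open Scope ereal_scope.

Record radon mu : Prop := {
  radon_finite : forall K : set T, compact K -> mu K < +oo ;
  radon_outer : forall A : set (borel t), measurable A ->
    mu A = ereal_inf [set mu U | U in [set U : set T | open U /\ A `<=` U]] ;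
  radon_inner : forall U : set T, open U ->
    mu U = ereal_sup [set mu K | K in [set K : set T | compact K /\ K `<=` U]]
}.

Definition measure_support mu : set T :=
  [set u | forall U : set T, open_nbhs u U -> 0 < mu U].

End borel_measures.

Definition Cc {R : realType} {T : topologicalType} : set (T -> R) :=
  [set f | continuous f /\ compact (closure [set t | f t != 0%R])].

Record left_haar_measure {R : realType} {G : topologicalGroupType}
    (mu : borel_measure R (1%g : G)) : Prop := {
  haar_radon : radon mu ;
  haar_neq0 : mu [set: G] <> 0%E ;
  haar_invariant : forall (g : G) (A : set (borel (1%g : G))), measurable A ->
    mu [set (g * a)%g | a in A] = mu A
}.

Record subsemigroup {G : topologicalGroupType} (P : set G) : Prop := {
  subsemigroup1 : P 1%g ;
  subsemigroupM : forall a b, P a -> P b -> P (a * b)%g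
}.

(* [act x a] is only meaningful for [a] in [P]. *)
Record right_action {G : topologicalGroupType} {X : topologicalType}
    (P : set G) (act : X -> G -> X) : Prop := {
  act_continuous :
    {within [set: X] `*` P, continuous (fun p : X * G => act p.1 p.2)} ;
  act1 : forall x, act x 1%g = x ;
  actM : forall x a b, P a -> P b -> act (act x a) b = act x (a * b)%g
}.

Definition injective_action {G : topologicalGroupType} {X : topologicalType}
  (P : set G) (act : X -> G -> X) : Prop :=
  forall a, P a -> injective (act ^~ a).

Section semidirect_product.
Context {G : topologicalGroupType} {X : topologicalType}.
Variables (P : set G) (act : X -> G -> X).

Definition semidirect : set (X * G) :=
  [set p | exists a b y,
     [/\ P a, P b, p.2 = (a * b^-1)%g & act p.1 a = act y b]].

(* The subtype of [X * G], with the topology induced from [X * G]. *)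
Definition groupoid : topologicalType := set_type semidirect.

Definition gpd_rng (c : groupoid) : X := (set_val c).1.

(* The default value of [xget] is never used, see [gpd_srcP]. *)
Definition gpd_src (c : groupoid) : X :=
  xget (gpd_rng c) [set y | forall a b, P a -> P b ->
    (set_val c).2 = (a * b^-1)%g -> act (gpd_rng c) a = act y b].

(* The product of [c] and [d] when [gpd_rng d = gpd_src c]; [insubd] then never returns
   its default value, see [gpd_mulE]. *)
Definition gpd_mul (c d : groupoid) : groupoid :=
  insubd c ((set_val c).1, ((set_val c).2 * (set_val d).2)%g).

Definition gpd_Q (x : X) : set G := [set g | semidirect (x, g)].

Definition gpd_fiber (x : X) : set groupoid := gpd_rng @^-1` [set x].

Hypotheses (hP : subsemigroup P) (hact : right_action P act).

Lemma semidirect_unit x : semidirect (x, 1%g).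
Proof.
exists 1%g, 1%g, x; split=> //=; try exact: subsemigroup1 hP.
by rewrite invg1 mulg1.
Qed.

Definition gpd_unit (x : X) : groupoid :=
  exist _ (x, 1%g) (mem_set (semidirect_unit x)).

Section well_defined.
Hypotheses (injact : injective_action P act).
Hypotheses (PPV : forall g, exists a b, [/\ P a, P b & g = (a * b^-1)%g]).

Lemma semidirect_rep x y a b c d : P a -> P b -> P c -> P d ->
  (a * b^-1 = c * d^-1)%g -> act x a = act y b -> act x c = act y d.
Proof.
move=> Pa Pb Pc Pd abcd xayb.
have [p [q [Pp Pq bd]]] := PPV (b^-1 * d)%g.
have dq : (d * q = b * p)%g.
  have -> : d = (b * (b^-1 * d))%g by rewrite mulgA mulgV mul1g.
  by rewrite bd -!mulgA mulVg mulg1.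
have cq : (c * q = a * p)%g.
  have -> : c = (a * (b^-1 * d))%g by rewrite mulgA abcd -mulgA mulVg mulg1.
  by rewrite bd -!mulgA mulVg mulg1.
apply: (injact Pq); rewrite (actM hact)// (actM hact)// cq dq.
by rewrite -(actM hact)// xayb (actM hact).
Qed.

Lemma gpd_srcP (c : groupoid) (a b : G) : P a -> P b ->
  (set_val c).2 = (a * b^-1)%g -> act (gpd_rng c) a = act (gpd_src c) b.
Proof.
move=> Pa Pb cab; rewrite /gpd_src; case: xgetP => [y _ yP|noy]; first exact: yP.
have [a' [b' [y [Pa' Pb' ca'b' xy]]]] := set_mem (valP c).
exfalso; apply: (noy y) => a1 b1 Pa1 Pb1 cab1.
by apply: (semidirect_rep Pa' Pb' Pa1 Pb1 _ xy); rewrite -ca'b' -cab1.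
Qed.

Lemma gpd_src_unique (c : groupoid) (a b : G) (y : X) : P a -> P b ->
  (set_val c).2 = (a * b^-1)%g -> act (gpd_rng c) a = act y b -> y = gpd_src c.
Proof.
by move=> Pa Pb cab xy; apply: (injact Pb); rewrite -xy; exact: gpd_srcP.
Qed.

Lemma gpd_mulE (c d : groupoid) : gpd_rng d = gpd_src c ->
  set_val (gpd_mul c d) = (gpd_rng c, ((set_val c).2 * (set_val d).2)%g).
Proof.
move=> rdsc; rewrite /gpd_mul [LHS](insubdK c)//; apply/mem_set.
have [a [b [y [Pa Pb cab xy]]]] := set_mem (valP c).
have [a' [b' [z [Pa' Pb' dab yz]]]] := set_mem (valP d).
have := gpd_src_unique Pa Pb cab xy; rewrite -rdsc => yE; subst y.
have [p [q [Pp Pq bpq]]] := PPV (b^-1 * a')%g.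
have aq : (a' * q = b * p)%g.
  have -> : a' = (b * (b^-1 * a'))%g by rewrite mulgA mulgV mul1g.
  by rewrite bpq -!mulgA mulVg mulg1.
exists (a * p)%g, (b' * q)%g, z; split; try exact: subsemigroupM.
- rewrite /= cab dab -mulgA (mulgA b^-1%g) bpq.
  by rewrite invgM !mulgA.
- rewrite /= -(actM hact)// xy (actM hact)// -aq -(actM hact)//.
  by rewrite yz (actM hact).
Qed.

End well_defined.

Section haar_system.
Context {R : realType}.
Local Open Scope ring_scope.

Record left_haar_system (nu : forall x, borel_measure R (gpd_unit x)) : Prop := {
  haar_system_radon : forall x, radon (nu x) ;
  haar_system_support : forall x, measure_support (nu x) = gpd_fiber x ;
  haar_system_continuous : forall f : groupoid -> R, Cc f ->
    continuous (fun x : X => \int[nu x]_c f c) ;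
  haar_system_invariant : forall (c : groupoid) (f : groupoid -> R), Cc f ->
    \int[nu (gpd_src c)]_(d in gpd_fiber (gpd_src c)) f (gpd_mul c d) =
    \int[nu (gpd_rng c)]_d f d
}.

(* The Radon measure lambda^x, which the integral formula determines uniquely.
   For [g] in [gpd_Q x], [insubd (gpd_unit x) (x, g)] is [(x, g)] as an element of the
   groupoid. *)
Record is_lambda (mu : borel_measure R (1%g : G)) (x : X)
    (lambda : borel_measure R (gpd_unit x)) : Prop := {
  lambda_radon : radon lambda ;
  lambda_integral : forall f : groupoid -> R, Cc f ->
    \int[lambda]_c f c = \int[mu]_(g in gpd_Q x) f (insubd (gpd_unit x) (x, g))
}.

End haar_system.

End semidirect_product.

(* Main.v *)
Require Import Defs.
From HB Require Import structures.
From mathcomp Require Import all_boot all_order all_algebra.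
From mathcomp Require Import all_classical all_reals all_analysis.
From mathcomp Require Import measurable_realfun.

Set Implicit Arguments.
Unset Strict Implicit.
Unset Printing Implicit Defensive.

Import Order.TTheory GRing.Theory Num.Theory.
Import numFieldNormedType.Exports.

Local Open Scope classical_set_scope.

(* A Haar system makes the range map open: a bump function f at an arrow c has
   positive integral for nu^(r c), hence for nu^x with x close to r c.  Around
   the arrow (xa, a^-1) with a in Int(P) the source map is continuous, because X
   is compact and P acts injectively, so X x Int(P) -> X is open.

   Conversely, lambda^x is the Haar measure restricted to the closed set Q_x,
   and only its continuity in x is at stake.  By (4), if g lies in Q_x Int(P)
   then it lies in Q_y for y close to x; if g is not in Q_x, it is not in Q_y
   for y close to x, the groupoid being closed.  The remaining set
   N = Q_x \ Q_x Int(P) is null, and dominated convergence applies.  Indeed no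
   two points n, n' of N satisfy n' = n p with p in Int(P), so N^-1 is disjoint
   from its left translates by elements of Int(P), which come arbitrarily close
   to 1; thus N^-1 is null, and then so is N by Fubini's theorem, without any
   use of the modular function. *)

(** * Countable bases: Lindelöf coverings and sequential continuity *)

Section second_countable_spaces.
Context {T : topologicalType}.
Hypothesis T_countable : @second_countable T.

Lemma second_countable_seq : exists F : nat -> set T,
  (forall n, open (F n)) /\
  forall x U, nbhs x U -> exists2 n, F n x & F n `<=` U.
Proof.
have [B cB [Bo Bnbhs]] := T_countable.
have [B0|[F]] := pfcard_geP cB.
  (* An empty base leaves no point in [T], so any sequence of open sets will do. *)
  exists (fun=> set0); split=> [n|x U Ux]; first exact: open0.
  by have [b [+ _] _] := Bnbhs x U Ux; rewrite B0.
have FB n : B (F n) by exact: funS.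
exists F; split=> [n|x U Ux]; first exact/Bo/FB.
have [b [Bb bx] bU] := Bnbhs x U Ux.
by have [n _ Fn] := @surj _ _ _ _ F _ Bb; exists n; rewrite Fn.
Qed.

(** Lindelöf's argument for a hereditary property: basic open sets without [P] are replaced by the
    empty set, whence the premise on [set0]. *)
Lemma open_countable_cover (P : set T -> Prop) (V : set T) :
  P set0 -> (forall U W, U `<=` W -> P W -> P U) ->
  (forall x, V x -> exists2 U, nbhs x U & P U) ->
  exists F : nat -> set T,
    [/\ forall n, open (F n), forall n, P (F n) & V `<=` \bigcup_n F n].
Proof.
move=> P0 Pmon Vloc; have [F [oF Fnbhs]] := second_countable_seq.
exists (fun n => if `[<P (F n)>] then F n else set0);
  split=> [n|n|x /Vloc[U Ux PU]].
- by case: ifP => _; [exact: oF|exact: open0].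
- by case: asboolP.
- have [n Fnx FnU] := Fnbhs x U Ux; exists n => //.
  by rewrite ifT//; apply/asboolP; exact: (Pmon _ _ FnU PU).
Qed.

(** Dominated convergence only handles sequences; this turns its conclusion into continuity in the
    base point of the fibre. *)
Lemma sequential_continuity_at {U : topologicalType} (f : T -> U) (x : T) :
  (forall u : nat -> T, u n @[n --> \oo] --> x ->
    f (u n) @[n --> \oo] --> f x) ->
  {for x, continuous f}.
Proof.
move=> fseq W fxW; apply: contrapT => nW.
have [F [oF Fnbhs]] := second_countable_seq.
(* [E n] is the intersection of those among the first basic sets that contain [x]; these form a
   decreasing base of neighbourhoods of [x]. *)
pose E n := [set y | forall i, (i <= n)%N -> F i x -> F i y].
have Fx n : nbhs x [set y | F n x -> F n y].
  have [Fnx|nFnx] := pselect (F n x); last by apply: nearW => y /nFnx.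
  by apply: filterS (open_nbhs_nbhs (conj (oF n) Fnx)) => y Fny _; exact: Fny.
have Ex n : nbhs x (E n).
  elim: n => [|n En].
    by apply: filterS (Fx 0%N) => y Fy i; rewrite leqn0 => /eqP->.
  apply: filterS (filterI En (Fx n.+1)) => y [Ey Fy] i.
  by rewrite leq_eqVlt => /predU1P[->//|]; rewrite ltnS; exact: Ey.
have Enot n : exists y, E n y /\ ~ W (f y).
  apply: contrapT => /forallNP H; apply: nW; apply: filterS (Ex n) => y Ey.
  by apply: contrapT => nWy; apply: (H y).
have [u uP] := choice Enot.
have ux : u n @[n --> \oo] --> x.
  move=> V /Fnbhs[k Fkx FkV]; exists k => // n /= kn; apply: FkV.
  exact: (uP n).1.
have [k _ kW] := fseq u ux _ fxW.
exact: (uP k).2 (kW k (leqnn k)).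
Qed.

End second_countable_spaces.

(** * Locally compact Hausdorff spaces: exhaustion by compact sets and bump functions *)

Section locally_compact_spaces.
Context {T : topologicalType}.
Hypotheses (T_lc : locally_compact [set: T]) (T_hausdorff : hausdorff_space T).

Lemma compact_nbhs (x : T) (U : set T) : nbhs x U ->
  exists K, [/\ nbhs x K, compact K & K `<=` U].
Proof.
move=> Ux; have [K] := T_lc (x := x) Logic.I; rewrite withinET => Kx [cK _].
have [V Vx VKU] := (compact_regular T_hausdorff cK Kx) _ (filterI Ux Kx).
exists (closure V); split.
- exact: filterS (@subset_closure _ V) Vx.
- by apply: (subclosed_compact _ cK); [exact: closed_closure|move=> y /VKU[]].
- by move=> y /VKU[].
Qed.

(** Lindelöf's argument, applied to the sets that some compact subset of [V] contains. *)
Lemma open_sigma_compact (V : set T) : @second_countable T -> open V ->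
  exists K : nat -> set T,
    (forall n, compact (K n)) /\ V = \bigcup_n K n.
Proof.
move=> sc oV.
pose P U := exists K, [/\ compact K, U `<=` K & K `<=` V].
have [||x Vx|F [oF PF VF]] := open_countable_cover (P := P) (V := V) sc.
- by exists set0; split=> //; exact: compact0.
- by move=> U W UW [K [cK WK KV]]; exists K; split=> //; exact: subset_trans WK.
- have [K [Kx cK KV]] := compact_nbhs (open_nbhs_nbhs (conj oV Vx)).
  exists K; [exact: Kx|exists K; split=> //].
- have {PF} PF n : exists K, [/\ compact K, F n `<=` K & K `<=` V] := PF n.
  have [K KP] := choice PF; exists K; split=> [n|]; first by have [] := KP n.
  apply/seteqP; split=> x.
    by move=> /VF[n _ Fx]; exists n => //; have [_ + _] := KP n; exact.
  by move=> [n _ Kx]; have [_ _] := KP n; exact.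
Qed.

(** The bump is one minus a Urysohn function separating [x] from the complement of [K°], where [K]
    is a compact neighbourhood of [x] inside [U]. It vanishes off [K], which bounds its support. *)
Lemma Cc_bump {R : realType} (x : T) (U : set T) : nbhs x U ->
  exists f : T -> R,
    [/\ Cc f, forall y, 0 <= f y, 0 < f x & forall y, f y != 0 -> U y]%R.
Proof.
move=> Ux; have [K [Kx cK KU]] := compact_nbhs Ux.
have oK : open (K°) by exact: open_interior.
have sepK : uniform_separator [set x] (~` K°).
  by apply: (locally_compact_completely_regular (R := R)) => //;
    exact: open_closedC.
pose f y := (1 - Urysohn (R := R) [set x] (~` K°) y)%R.
have f0 y : f y != 0%R -> K y.
  apply: contra_neqP => nKy.
  apply/eqP; rewrite subr_eq0 eq_sym; apply/eqP.
  by apply: (Urysohn_sub1 (R := R) sepK); exists y => // /interior_subset.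
exists f; split.
- split.
    move=> y; apply: continuousB; first exact: cst_continuous.
    exact: Urysohn_continuous.
  apply: (subclosed_compact _ cK); first exact: closed_closure.
  have /closure_id -> := compact_closed T_hausdorff cK.
  exact: closureS.
- move=> y; rewrite /f subr_ge0.
  have /(_ _ (imageT _ y)) := @Urysohn_range T R [set x] (~` K°).
  by rewrite /= in_itv/= => /andP[].
- have -> : f x = 1%R; last exact: ltr01.
  have -> : 1%R = (1 - 0)%R :> R by rewrite subr0.
  by congr (1 - _)%R; apply: (Urysohn_sub0 (R := R) sepK); exists x.
- by move=> y /f0/KU.
Qed.

End locally_compact_spaces.

(** The image filter clusters at some point of [C]; closedness of [A] puts this point in [A], so
    that it lifts to the subtype. *)
Lemma compact_set_val_preimage {T : topologicalType} (A C : set T) :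
  closed A -> compact C -> compact (@set_val T A @^-1` C).
Proof.
move=> clA cC F PF FC.
have [p [Cp clp]] := cC (@set_val T A @ F) (fmap_proper_filter _ PF) FC.
have Ap : A p.
  apply: clA => U Up; have [||q [[q' _ <-] Uq]] := clp (range (@set_val T A)) U.
  - by apply: nearW => q; exists q.
  - exact: Up.
  by exists (set_val q'); split => //; exact: set_mem (valP q').
exists (exist _ p (mem_set Ap)); split=>
  // D E FD /= [_ /= [[W oW <-] /= Wp WE]].
have [||q [[q' Dq' <-] Wq]] := clp (@set_val T A @` D) W.
- change (F (@set_val T A @^-1` (@set_val T A @` D))).
  exact: filterS (@preimage_image _ _ _ D) FD.
- exact: open_nbhs_nbhs.
- by exists q'; split => //; exact: WE.
Qed.

(** * Borel sets, Borel maps and locally null sets *)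

Section borel_sets.
Context {T : topologicalType} {t : T}.

Lemma borel_open (U : set T) : open U -> measurable (U : set (borel t)).
Proof. exact: sub_sigma_algebra. Qed.

Lemma borel_closed (A : set T) : closed A -> measurable (A : set (borel t)).
Proof.
move=> clA; rewrite -[A]setCK.
by apply: (@measurableC _ (borel t)); apply: borel_open; exact: closed_openC.
Qed.

Lemma borel_measurable_fun {d} {S : measurableType d} (f : S -> T) :
  (forall U : set T, open U -> measurable (f @^-1` U)) ->
  measurable_fun [set: S] (f : S -> borel t).
Proof.
move=> mf; refine (@measurability _ _ S (borel t) setT f (@open (pointed_at t))
  erefl _).
by move=> _ [U oU <-]; rewrite setTI; exact: mf.
Qed.

Lemma borel_continuous_measurable {R : realType} (f : T -> R) :
  continuous f -> measurable_fun [set: borel t] (f : borel t -> R).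
Proof.
move=> cf; apply: (measurability _ (RGenOInfty.measurableE R)).
move=> _ [_ [x ->] <-]; rewrite setTI; apply: borel_open.
by apply: open_comp => [y _|]; [exact: cf|exact: interval_open].
Qed.

End borel_sets.

Section borel_measures.
Context {R : realType} {T : topologicalType} {t : T}.
Variable mu : borel_measure R t.
Local Open Scope ereal_scope.

Lemma locally_null_compact (K : set T) : hausdorff_space T -> compact K ->
  (forall u, K u -> exists2 U, open_nbhs u U & mu U = 0) -> mu K = 0.
Proof.
move=> hT cK Kloc.
have mK : measurable (K : set (borel t)) by apply: borel_closed;
  exact: compact_closed hT cK.
pose null (N : set T) := mu.-negligible (N : set (borel t)).
pose F : set_system (set T) := fun A =>
  exists2 N, null N & forall B, null B -> N `<=` B -> A B.
have FF : Filter F.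
  split=> [|A B [N nN NA] [M nM MB]|A B AB [N nN NA]].
  - by exists set0 => //; exact: negligible_set0.
  - exists (N `|` M); first exact: negligibleU.
    by move=> C nC NMC; split; [apply: NA|apply: MB] => //;
      apply: subset_trans NMC.
  - by exists N => // C nC NC; exact/AB/NA.
(* Compactness is used along the filter of large null sets, instead of with a
   finite subcover. *)
have [u Ku|N nN NK] :=
    (compact_near_coveringP K).1 cK _ F (fun B u => B u) FF.
  have [U [oU Uu] U0] := Kloc u Ku.
  exists (U, [set B | U `<=` B]) => /=; last by move=> [v B] [/= Uv]; exact.
  split=> /=; first exact: open_nbhs_nbhs.
  exists U => //; exists U; split => //; exact: borel_open.
by apply: (measure_negligible mK); apply: (negligibleS _ nN); exact: NK.
Qed.

End borel_measures.

(** * Translations in a topological group *)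

Section topological_groups.
Context {G : topologicalGroupType}.
Local Open Scope group_scope.

Lemma mulgl_continuous (g : G) : continuous (fun h : G => g * h).
Proof.
move=> h.
apply: (@continuous_comp _ _ _ (fun h : G => (g, h)) (fun p => p.1 * p.2)).
  by apply: cvg_pair => //; exact: cvg_cst.
exact: mulg_continuous.
Qed.

Lemma mulgr_continuous (g : G) : continuous (fun h : G => h * g).
Proof.
move=> h.
apply: (@continuous_comp _ _ _ (fun h : G => (h, g)) (fun p => p.1 * p.2)).
  by apply: cvg_pair => //; exact: cvg_cst.
exact: mulg_continuous.
Qed.

Lemma open_preimage_mulgl (g : G) (U : set G) : open U ->
  open ((fun h => g * h) @^-1` U).
Proof. by move=> oU; apply: open_comp => // h _; exact: mulgl_continuous. Qed.

Lemma open_preimage_mulgr (g : G) (U : set G) : open U ->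
  open ((fun h => h * g) @^-1` U).
Proof. by move=> oU; apply: open_comp => // h _; exact: mulgr_continuous. Qed.

Lemma open_mulg_set (A D : set G) : open D ->
  open [set a * d | a in A & d in D].
Proof.
move=> oD; rewrite [X in open X](_ : _ =
    \bigcup_(a in A) (fun h => a^-1 * h) @^-1` D).
  by apply: bigcup_open => a _; exact: open_preimage_mulgl.
apply/seteqP; split=> [_ [a Aa [d Dd <-]]|h [a Aa Dah]].
  by exists a => //; rewrite /preimage/= mulgA mulVg mul1g.
by exists a => //; exists (a^-1 * h) => //; rewrite mulgA mulgV mul1g.
Qed.

End topological_groups.

(** * Borel sets of a product of second countable spaces *)

Section product_borel.
Context {T U : topologicalType} {t : T} {u : U}.
Hypotheses (T_countable : @second_countable T).
Hypotheses (U_countable : @second_countable U).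

(** With countable bases, [W] is a countable union of open rectangles. This is what lets Fubini's
    theorem be applied to closed subsets of [G * G]. *)
Lemma open_measurable_prod (W : set (T * U)) : open W ->
  measurable (W : set (borel t * borel u)).
Proof.
move=> oW.
have [E [oE Enbhs]] := second_countable_seq T_countable.
have [F [oF Fnbhs]] := second_countable_seq U_countable.
pose rect n m : set (borel t * borel u) :=
  if `[<E n `*` F m `<=` W>] then E n `*` F m else set0.
have -> : W = \bigcup_n \bigcup_m rect n m.
  apply/seteqP; split=> [[x y] Wxy|[x y] [n _ [m _]]]; last first.
    by rewrite /rect; case: asboolP => // + ?; apply.
  have [[A B] /= [/Enbhs[n Enx EnA] /Fnbhs[m Fmy FmB]] ABW] : nbhs (x, y) W.
    exact: open_nbhs_nbhs.
  exists n => //; exists m => //; rewrite /rect ifT//;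
    apply/asboolP => -[a b] [/= Ea Fb].
  by apply: ABW; split; [exact: EnA|exact: FmB].
apply: bigcupT_measurable => n; apply: bigcupT_measurable => m.
rewrite /rect; case: asboolP => _; last exact: measurable0.
by apply: measurableX; exact: borel_open.
Qed.

End product_borel.

(** * Null sets of Haar measure *)

Section haar_measure.
Context {R : realType} {G : topologicalGroupType}.
Variable mu : borel_measure R (1%g : G).
Hypothesis mu_haar : left_haar_measure mu.
Hypotheses (G_hausdorff : hausdorff_space G) (G_countable : @second_countable
  G).
Hypothesis G_lc : locally_compact [set: G].
Local Open Scope ereal_scope.

Lemma mulgl_measurable (g : G) :
  measurable_fun [set: borel (1%g : G)]
    ((fun h => g * h)%g : borel (1%g : G) -> borel (1%g : G)).
Proof.
apply: borel_measurable_fun => U oU; apply: borel_open.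
exact: open_preimage_mulgl.
Qed.

Lemma haar_preimage_mulgl (g : G) (A : set G) :
  measurable (A : set (borel (1%g : G))) ->
  mu ((fun h => g * h)%g @^-1` A) = mu A.
Proof.
move=> mA; rewrite -(haar_invariant mu_haar g^-1%g mA); congr (mu _).
apply/seteqP; split=> [h Agh|_ [a Aa <-]].
  by exists (g * h)%g => //; rewrite mulgA mulVg mul1g.
by rewrite /preimage/= mulgA mulgV mul1g.
Qed.

(** If [U] were null, its translates would be null neighbourhoods of all points; compact sets would
    then be null, and by inner regularity so would [G]. *)
Lemma haar_open_gt0 (U : set G) : open U -> U !=set0 -> 0 < mu U.
Proof.
move=> oU [u Uu]; rewrite lt_neqAle measure_ge0 andbT eq_sym.
apply/eqP => U0; apply: (haar_neq0 mu_haar).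
rewrite (radon_inner (haar_radon mu_haar) openT).
apply/eqP; rewrite eq_le; apply/andP; split; last first.
  apply: ereal_sup_ubound; exists set0; last exact: measure0.
  by split => //; exact: compact0.
apply: ge_ereal_sup => _ [K [cK _] <-].
rewrite locally_null_compact// => h _.
exists ((fun k => (u * h^-1) * k)%g @^-1` U); last first.
  by rewrite haar_preimage_mulgl//; exact: borel_open.
split; first exact: open_preimage_mulgl.
by rewrite /preimage/= -mulgA mulVg mulg1.
Qed.

Lemma haar_sigma_finite : sigma_finite setT mu.
Proof.
have [K [cK KT]] := open_sigma_compact G_lc G_hausdorff G_countable openT.
exists K => // n; split.
  by apply: borel_closed; exact: compact_closed G_hausdorff (cK n).
exact: radon_finite (haar_radon mu_haar) _ (cK n).
Qed.

(** Tonelli's theorem for the set of pairs [(h, k)] with [h^-1 * k] in [N]: its sections are [h N]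
    in one direction and [k N^-1] in the other, so [mu N * mu G = 0]. *)
Lemma haar_null_invg (N : set G) : closed N ->
  mu ((fun g => g^-1)%g @^-1` N) = 0 -> mu N = 0.
Proof.
move=> clN N0.
(* Tonelli's theorem is stated for bundled sigma-finite measures, so [mu] is repackaged as [m]. *)
pose mu_sfinite :=
  isSFinite.Build _ _ _ _ (sfinite_measure_sigma_finite haar_sigma_finite).
pose mu_sigma_finite := isSigmaFinite.Build _ _ _ _ haar_sigma_finite.
pose m := HB.pack_for (SigmaFiniteMeasure.type (borel (1%g : G)) R)
  (Measure.sort mu) mu_sfinite mu_sigma_finite.
pose f (p : G * G) : G := (p.1^-1 * p.2)%g.
have cf : continuous f.
  move=> p; apply: (@continuous_comp _ _ _ (fun p : G * G => (p.1^-1, p.2)%g)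
    (fun p => p.1 * p.2)%g); last exact: mulg_continuous.
  apply: cvg_pair; last exact: cvg_snd.
  apply: (@continuous_comp _ _ _ fst (fun g : G => g^-1)%g);
    first exact: cvg_fst.
  exact: invg_continuous.
pose A : set (borel (1%g : G) * borel (1%g : G)) := f @^-1` N.
have mA : measurable A.
  rewrite -[A]setCK; apply: measurableC.
  apply: (open_measurable_prod G_countable G_countable).
  by apply: closed_openC; apply: closed_comp => // p _; exact: cf.
have := indic_fubini_tonelli m m mA.
rewrite indic_fubini_tonelli_FE// indic_fubini_tonelli_GE//.
have -> : m \o xsection A = cst (mu N).
  apply/funext => h; rewrite -(haar_preimage_mulgl h^-1%g (borel_closed clN)).
  by congr (mu _); apply/seteqP; split=> k; rewrite /xsection/= inE.
have -> : m \o ysection A = cst 0.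
  apply/funext => g; rewrite /cst -N0.
  have /borel_closed mN : closed ((fun g => g^-1)%g @^-1` N).
    by apply: closed_comp => // h _; exact: invg_continuous.
  rewrite -(haar_preimage_mulgl g^-1%g (mN _)).
  by congr (mu _); apply/seteqP; split=> k; rewrite /ysection/= inE /preimage/=
    invgM invgK.
rewrite integral0 integral_cst//= => /eqP;
  rewrite mule_eq0 => /orP[/eqP//|/eqP].
by move=> /(haar_neq0 mu_haar).
Qed.

Lemma haar_null_translates (M D : set G) : closed M -> closure D 1%g ->
  (forall m d, M m -> D d -> ~ M (d * m)%g) -> mu M = 0.
Proof.
move=> clM D1 MD; have mM := borel_closed clM (t := 1%g).
have [K [cK KT]] := open_sigma_compact G_lc G_hausdorff G_countable openT.
have cMK n : compact (M `&` K n).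
  by rewrite setIC; exact: compact_closedI (cK n) clM.
have mMK n : measurable (M `&` K n : set (borel (1%g : G))).
  exact: borel_closed (compact_closed G_hausdorff (cMK n)).
(* The compact pieces of [M] have finite measure, which the strict inequality [c < c + c] below
   relies on. *)
suff MK0 n : mu (M `&` K n) = 0.
  apply: (measure_negligible mM); rewrite -[X in mu.-negligible X]setIT KT
    setI_bigcupr.
  apply: negligible_bigcup => n.
  by exists (M `&` K n); split; [exact: mMK|exact: MK0|].
(* An open set of measure less than twice that of the compact set [M `&` K n]
   and containing it contains its translates by elements close to 1, which can
   therefore not be disjoint from it. *)
apply: contrapT => /eqP MK0; pose c := mu (M `&` K n).
have c_gt0 : 0 < c by rewrite lt_neqAle eq_sym MK0 measure_ge0.
have c_fin : c \is a fin_num.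
  by rewrite ge0_fin_numE; [exact: radon_finite (haar_radon mu_haar) _ (cMK
    n)|exact: ltW].
have : c < c + c by rewrite -[X in X < _]adde0 lteD2lE.
rewrite {1}/c (radon_outer (haar_radon mu_haar) (mMK n)) => /ereal_inf_lt.
move=> [_ [U [oU KU] <-] Ucc].
have V1 : \forall v \near 1%g, M `&` K n `<=` [set k | U (v * k)%g].
  apply: ((compact_near_coveringP _).1 (cMK n)) => k Kk.
  have Uk : nbhs (1 * k)%g U by rewrite mul1g; apply: open_nbhs_nbhs;
    split=> //; exact: KU.
  have [[A B] [/= A1 Bk] AB] := @mulg_continuous G (1%g, k) _ Uk.
  by exists (B, A) => //= -[k' v] [/= Bk' Av]; exact: (AB (v, k')).
have [d [Dd Vd]] := D1 _ V1.
pose dK := [set (d * a)%g | a in M `&` K n].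
have dK_pre : dK = (fun h => d^-1 * h)%g @^-1` (M `&` K n).
  apply/seteqP; split=> [_ [a Ka <-]|h Kh].
    by rewrite /preimage/= mulgA mulVg mul1g.
  by exists (d^-1 * h)%g => //; rewrite mulgA mulgV mul1g.
have mdK : measurable (dK : set (borel (1%g : G))).
  by rewrite dK_pre -[X in measurable X]setTI; exact: mulgl_measurable.
suff : c + c <= mu U by rewrite leNgt Ucc.
have -> : c + c = mu ((M `&` K n) `|` dK).
  have dK_c : mu dK = c by rewrite dK_pre haar_preimage_mulgl.
  rewrite measureU//; first exact: (congr1 (fun x => c + x) (esym dK_c)).
  by apply/seteqP; split=> // h [[Mh _] [a [Ma _] dah]]; apply: (MD a d) => //;
    rewrite dah.
apply: le_measure; rewrite ?inE//; [exact: measurableU|exact: borel_open|].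
by move=> h [/KU//|[a Ka <-]]; exact: Vd.
Qed.

(** This is used with [A] equal to [Q_x] and [D] equal to [P°]. If [m] and [d * m] both had their
    inverse in the difference set, then [m^-1 = (d * m)^-1 * d] would be a product from [A] and [D],
    which that set excludes. *)
Lemma haar_null_boundary (A D : set G) : closed A -> open D -> closure D 1%g ->
  mu (A `\` [set a * d | a in A & d in D]%g) = 0.
Proof.
move=> clA oD D1; pose AD := [set a * d | a in A & d in D]%g.
have clN : closed (A `\` AD).
  by rewrite setDE; apply: closedI => //; apply: open_closedC;
    exact: open_mulg_set.
apply: haar_null_invg => //; apply: (haar_null_translates (D := D)) => //.
  by apply: closed_comp => // g _; exact: invg_continuous.
move=> m d [Am nADm] Dd [Adm _]; apply: nADm.
by exists (d * m)^-1%g => //; exists d => //; rewrite invgM -mulgA mulVg mulg1.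
Qed.

End haar_measure.

(** * Hausdorff products and subspaces *)

Lemma continuous_cluster {S T : topologicalType} (f : S -> T) (x y : S) :
  continuous f -> cluster (nbhs x) y -> cluster (nbhs (f x)) (f y).
Proof.
move=> cf xy A B Afx Bfy; have [z [Az Bz]] := xy _ _ (cf _ _ Afx) (cf _ _ Bfy).
by exists (f z).
Qed.

Lemma hausdorff_prod {S T : topologicalType} :
  hausdorff_space S -> hausdorff_space T -> hausdorff_space (S * T)%type.
Proof.
move=> hS hT [x1 x2] [y1 y2] xy; congr pair.
- exact: hS (continuous_cluster (fun p => @cvg_fst _ _ _ _ _) xy).
- exact: hT (continuous_cluster (fun p => @cvg_snd _ _ _ _ _) xy).
Qed.

Lemma set_val_continuous {T : topologicalType} (A : set T) :
  continuous (@set_val T A).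
Proof. exact: initial_continuous. Qed.

Lemma hausdorff_set_type {T : topologicalType} (A : set T) :
  hausdorff_space T -> hausdorff_space (set_type A).
Proof.
move=> hT x y xy; apply: val_inj.
exact: hT (continuous_cluster (@set_val_continuous _ A) xy).
Qed.

(** * Topology of the semi-direct product groupoid *)

Section semidirect_product_topology.
Context {G : topologicalGroupType} {X : topologicalType}.
Context {P : set G} {act : X -> G -> X}.
Hypotheses (G_hausdorff : hausdorff_space G) (G_lc : locally_compact [set: G]).
Hypotheses (X_hausdorff : hausdorff_space X) (X_compact : compact [set: X]).
Hypothesis hP : subsemigroup P.
Hypothesis PPV : forall g, exists a b, [/\ P a, P b & g = (a * b^-1)%g].
Hypothesis P_interior : P `<=` closure (P°).
Hypotheses (hact : right_action P act) (injact : injective_action P act).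
Local Open Scope group_scope.

(** The translate [a P°] is open and contained in [P]. *)
Lemma interior_mulgl (a d : G) : P a -> P° d -> P° (a * d).
Proof.
move=> Pa Pd; rewrite /interior nbhsE.
exists ((fun h => a^-1 * h) @^-1` (P°)) => [|h].
  split; first exact/open_preimage_mulgl/open_interior.
  by rewrite /preimage/= mulgA mulVg mul1g.
rewrite /preimage/= => /interior_subset Ph.
by rewrite -[h]mul1g -(mulgV a) -mulgA; apply: (subsemigroupM hP).
Qed.

Lemma interior_mulgr (a d : G) : P a -> P° d -> P° (d * a).
Proof.
move=> Pa Pd; rewrite /interior nbhsE.
exists ((fun h => h * a^-1) @^-1` (P°)) => [|h].
  split; first exact/open_preimage_mulgr/open_interior.
  by rewrite /preimage/= -mulgA mulgV mulg1.
rewrite /preimage/= => /interior_subset Ph.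
by rewrite -[h]mulg1 -(mulVg a) mulgA; apply: (subsemigroupM hP).
Qed.

Lemma interior_closure1 : closure (P°) 1.
Proof. exact/P_interior/(subsemigroup1 hP). Qed.

(** Numerator and denominator of a fraction for [g] are multiplied on the right by one element of
    [P°]. Interior elements are wanted because the action is jointly continuous in a full
    neighbourhood of them. *)
Lemma quotient_interior (g : G) : exists2 b, P° b & P° (g * b).
Proof.
have [a [b [Pa Pb ->]]] := PPV g.
have [c [Pc _]] := interior_closure1 filterT.
exists (b * c); first exact: interior_mulgl.
by rewrite -mulgA (mulgA b^-1) mulVg mul1g; exact: interior_mulgl.
Qed.

Lemma act_within (x : X) (a : G) (W : set X) : P a -> nbhs (act x a) W ->
  nbhs (x, a) [set p : X * G | P p.2 -> W (act p.1 p.2)].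
Proof.
move=> Pa Wxa; have xa : ([set: X] `*` P) (x, a) by split.
have : within ([set: X] `*` P) (nbhs (x, a)) ((fun p => act p.1 p.2) @^-1` W).
  by rewrite nbhs_subspace_in//; exact: (act_continuous hact (x := (x, a)) Wxa).
move=> H; apply: (@filterS _ _ (nbhs_filter (x, a)) _ _ _ H) => -[y b] Wyb Pb.
exact: Wyb.
Qed.

Lemma act_continuous_at (x : X) (a : G) : P° a ->
  {for (x, a), continuous (fun p : X * G => act p.1 p.2)}.
Proof.
move=> Pa W Wxa.
have XP : nbhs (x, a) [set p : X * G | P p.2].
  by exists ([set: X], P) => [|p []//]; split=> //; exact: filterT.
apply: filterS (filterI XP (act_within (interior_subset Pa) Wxa)) => p [Pp].
exact.
Qed.

Lemma act_continuous_l (a : G) : P a -> continuous (act ^~ a).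
Proof.
move=> Pa x W /(act_within Pa) [[A B] [/= Ax Ba] AB].
apply: filterS Ax => y Ay; apply: (AB (y, a)) => //.
by split=> //; exact: nbhs_singleton Ba.
Qed.

(** By [semidirect_rep], the existence of [y] does not depend on the fraction representing [g], so
    any convenient denominator can test membership. *)
Lemma semidirectE (x : X) (g b : G) : P b -> P (g * b) ->
  semidirect P act (x, g) <-> exists y, act x (g * b) = act y b.
Proof.
move=> Pb Pgb; split=> [[c [d [y [Pc Pd /= gcd xy]]]]|[y xy]].
  exists y; apply: (semidirect_rep hact injact PPV Pc Pd Pgb Pb _ xy).
  by rewrite -gcd -mulgA mulgV mulg1.
by exists (g * b), b, y; split=> //=; rewrite -mulgA mulgV mulg1.
Qed.

(** A denominator [b] with [g * b] in [P°] also serves all [g'] near [g]. Membership of [(x', g')]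
    then says that [act x' (g' * b)] lies in [X b], which is compact and hence closed. *)
Lemma semidirect_closed : closed (semidirect P act).
Proof.
rewrite -openC openE => -[x g] nxg.
have [b Pb Pgb] := quotient_interior g.
have [Pb' Pgb'] := (interior_subset Pb, interior_subset Pgb).
have clXb : closed (range (act ^~ b)).
  apply: (compact_closed X_hausdorff); apply: continuous_compact => //.
  by apply: continuous_subspaceT; exact: act_continuous_l.
pose f (p : X * G) := act p.1 (p.2 * b).
have cf : {for (x, g), continuous f}.
  apply: (@continuous_comp _ _ _ (fun p : X * G => (p.1, p.2 * b))
    (fun p => act p.1 p.2)); last exact: act_continuous_at.
  apply: cvg_pair; first exact: cvg_fst.
  apply: (@continuous_comp _ _ _ snd (fun g => g * b)); first exact: cvg_snd.
  exact: mulgr_continuous.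
have Wxg : nbhs (f (x, g)) (~` range (act ^~ b)).
  apply: open_nbhs_nbhs; split; first exact: closed_openC.
  move=> [y _ xy]; apply: nxg; apply/(semidirectE _ Pb') => //.
  by exists y.
have Pxg : nbhs (x, g) [set p : X * G | P (p.2 * b)].
  have /mulgr_continuous Pg : nbhs (g * b) P by [].
  exists ([set: X], (fun h => h * b) @^-1` P) => /=; last by move=> p [].
  by split=> //; exact: filterT.
have fxg : nbhs (x, g) (f @^-1` ~` range (act ^~ b)) := cf _ Wxg.
apply: (@filterS _ _ (nbhs_filter (x, g)) _ _ _ (filterI fxg Pxg)) => -[x' g'].
move=> /= [fW Pg'b].
move=> /(semidirectE _ Pb' Pg'b)[y xy]; apply: fW.
by exists y.
Qed.

Lemma gpd_Q_closed (x : X) : closed (gpd_Q P act x).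
Proof.
apply: (@closed_comp _ _ (fun g => (x, g))); last exact: semidirect_closed.
by move=> g _; apply: cvg_pair => //; exact: cvg_cst.
Qed.

(** If [(x, g)] has source [y], the new arrow has source [act y p]. The common multiple
    [p * d = b * c], obtained by writing [b^-1 * p] as a fraction, provides its numerator and
    denominator. *)
Lemma gpd_Q_mulg (x : X) (g p : G) : gpd_Q P act x g -> P p ->
  gpd_Q P act x (g * p).
Proof.
move=> [a [b [y [Pa Pb /= gab xy]]]] Pp.
have [c [d [Pc Pd bp]]] := PPV (b^-1 * p).
have pd : p * d = b * c.
  have -> : p = b * (b^-1 * p) by rewrite mulgA mulgV mul1g.
  by rewrite bp -!mulgA mulVg mulg1.
exists (a * c), d, (act y p); split=> //=; first exact: (subsemigroupM hP).
  by rewrite gab -!mulgA bp.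
by rewrite -(actM hact)// xy !(actM hact)// pd.
Qed.

Lemma groupoid_hausdorff : hausdorff_space (groupoid P act).
Proof. exact/hausdorff_set_type/hausdorff_prod. Qed.

Lemma gpd_rng_continuous : continuous (@gpd_rng _ _ P act).
Proof.
move=> c; apply: (@continuous_comp _ _ _ set_val fst); last exact: cvg_fst.
exact: set_val_continuous.
Qed.

Lemma gpd_snd_continuous : continuous (fun c : groupoid P act => (set_val c).2).
Proof.
move=> c; apply: (@continuous_comp _ _ _ set_val snd); last exact: cvg_snd.
exact: set_val_continuous.
Qed.

(** As [X] is compact and the groupoid closed in [X * G], the arrows with second component in a
    compact set form a compact set. *)
Lemma groupoid_locally_compact : locally_compact [set: groupoid P act].
Proof.
move=> c _; rewrite withinET.
have [K [Kg cK _]] := compact_nbhs G_lc G_hausdorff (x :=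
  (set_val c).2) filterT.
pose C : set (groupoid P act) := set_val @^-1` ([set: X] `*` K).
have cC : compact C.
  by apply: compact_set_val_preimage; [exact: semidirect_closed|exact:
    compact_setX].
exists C; last by split=> //; exact: compact_closed groupoid_hausdorff cC.
have CK : nbhs c ((fun d : groupoid P act => (set_val d).2) @^-1` K) :=
  gpd_snd_continuous Kg.
by apply: (filterS _ CK) => d Kd; split.
Qed.

Lemma gpd_fiber_closed (x : X) : closed (@gpd_fiber _ _ P act x).
Proof.
apply: closed_comp => [c _|]; first exact: gpd_rng_continuous.
exact/accessible_closed_set1/hausdorff_accessible.
Qed.

End semidirect_product_topology.

(** * Boundedness and integrability of compactly supported functions *)

Section compactly_supported_functions.
Context {R : realType} {T : topologicalType}.
Local Open Scope ring_scope.

Lemma Cc_bounded (f : T -> R) : Cc f -> exists M, forall x, `|f x| <= M.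
Proof.
move=> [cf cK]; set K := closure _ in cK.
have : compact (f @` K).
  by apply: continuous_compact => //; exact: continuous_subspaceT.
move=> /compact_bounded[M [_ fM]]; exists (`|M| + 1) => x.
have [->|fx0] := eqVneq (f x) 0; first by rewrite normr0 addr_ge0.
apply: fM; first by rewrite (le_lt_trans (ler_norm M))// ltrDl.
by exists x => //; exact: subset_closure.
Qed.

Lemma Cc_integrable {t : T} (mu : borel_measure R t) (f : T -> R) :
  hausdorff_space T -> radon mu -> Cc f -> mu.-integrable setT (EFin \o f).
Proof.
move=> hT rmu Ccf; have [M fM] := Cc_bounded Ccf.
have [cf cK] := Ccf; set K := closure _ in cK.
have mK : measurable (K : set (borel t)).
  by apply: borel_closed; exact: closed_closure.
have /integrable_mkcond : mu.-integrable (K : set (borel t)) (EFin \o f).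
  apply: measurable_bounded_integrable => //.
  - exact: radon_finite rmu _ cK.
  - by apply: measurable_funTS; exact: borel_continuous_measurable.
  - exists M; split; first exact: num_real.
    by move=> N /ltW MN x _ /=; exact: le_trans MN.
move=> /(_ mK); congr (mu.-integrable _ _).
apply/funext => x; rewrite /patch; case: ifPn => // nKx.
apply/esym/eqP; apply: contraNT nKx => fx0.
by apply/mem_set/subset_closure => /=; rewrite -eqe.
Qed.

End compactly_supported_functions.

(** * A Haar system makes the range map open *)

Section haar_system_open.
Context {R : realType} {G : topologicalGroupType} {X : topologicalType}.
Context {P : set G} {act : X -> G -> X}.
Hypotheses (G_hausdorff : hausdorff_space G) (G_lc : locally_compact [set: G]).
Hypotheses (X_hausdorff : hausdorff_space X) (X_compact : compact [set: X]).
Hypothesis hP : subsemigroup P.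
Hypothesis PPV : forall g, exists a b, [/\ P a, P b & g = (a * b^-1)%g].
Hypothesis P_interior : P `<=` closure (P°).
Hypotheses (hact : right_action P act) (injact : injective_action P act).
Variable nu : forall x, borel_measure R (gpd_unit act hP x).
Hypothesis nu_haar : left_haar_system nu.

Let gpd_hausdorff : hausdorff_space (groupoid P act).
Proof. exact: groupoid_hausdorff. Qed.

Let gpd_lc : locally_compact [set: groupoid P act].
Proof. exact: groupoid_locally_compact. Qed.

(** The support condition only gives each point off the fibre a null neighbourhood; compactness and
    inner regularity make the whole complement null. *)
Lemma haar_system_fiberC (x : X) : nu x (~` gpd_fiber x) = 0%E.
Proof.
have oF : open (~` @gpd_fiber _ _ P act x).
  by apply: closed_openC; exact: gpd_fiber_closed.
rewrite (radon_inner (haar_system_radon nu_haar x) oF).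
apply/eqP; rewrite eq_le; apply/andP; split; last first.
  apply: ereal_sup_ubound; exists set0; last exact: measure0.
  by split => //; exact: compact0.
apply: ge_ereal_sup => _ [K [cK KF] <-].
rewrite locally_null_compact// => c /KF.
rewrite -(haar_system_support nu_haar) => /existsNP[U /not_implyP[Uc nU]].
exists U => //; apply/eqP; rewrite -measure_le0 leNgt.
exact/negP.
Qed.

Lemma haar_system_range_open (c : groupoid P act) (U : set (groupoid P act)) :
  nbhs c U -> nbhs (gpd_rng c) (@gpd_rng _ _ P act @` U).
Proof.
move=> Uc; have [f [Ccf f_ge0 fc_gt0 fU]] := Cc_bump gpd_lc gpd_hausdorff (R :=
  R) Uc.
pose If x := (\int[nu x]_d f d)%R.
(* The real integral [If] is a [fine] of the extended one, hence 0 where the latter is infinite;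
   integrability excludes this. *)
have IfE x : (\int[nu x]_d (f d)%:E)%E = (If x)%:E.
  rewrite fineK//; apply: integrable_fin_num => //.
  by apply: Cc_integrable => //; exact: haar_system_radon nu_haar x.
have If0 x : If x = 0%R <-> nu x (f @^-1` [set r | r != 0%R]) = 0%E.
  have mf : measurable_fun [set: borel (gpd_unit act hP x)] (fun d => (f d)%:E).
    by apply/measurable_EFinP; apply: borel_continuous_measurable; exact: Ccf.1.
  have mf0 : measurable (f @^-1` [set r | r != 0%R] : set (borel (gpd_unit act
    hP x))).
    by apply: borel_open; apply: open_comp => [d _|];
      [exact: Ccf.1|exact: open_neq].
  have -> : If x = 0%R <-> (\int[nu x]_d `|(f d)%:E| = 0)%E.
    under eq_integral => d _ do rewrite gee0_abs ?lee_fin//.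
    by rewrite IfE; split=> [->//|[]].
  rewrite (ae_eq_integral_abs (nu x) measurableT mf).
  split=> [[A [mA A0 fA]]|f0].
    apply: (measure_negligible mf0); exists A; split=> // d fd; apply: fA => /=.
    by move=> /(_ Logic.I)[] /eqP; apply/negP.
  exists (f @^-1` [set r | r != 0%R]); split=> // d /= nfd; apply/eqP => fd.
  by apply: nfd => _; rewrite fd.
have Ifc : (If (gpd_rng c) != 0)%R.
  apply/eqP => /If0 fc0.
  have : measure_support (nu (gpd_rng c)) c by rewrite (haar_system_support
    nu_haar).
  move=> /(_ (f @^-1` [set r | r != 0%R])); rewrite fc0 ltxx => nfc.
  suff : open_nbhs c (f @^-1` [set r | r != 0%R]) by move=> /nfc.
  split.
    by apply: open_comp => [d _|]; [exact: Ccf.1|exact: open_neq].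
  by rewrite /preimage/= gt_eqF.
have Ifnbhs : nbhs (gpd_rng c) (If @^-1` [set r | r != 0%R]).
  apply: (haar_system_continuous nu_haar Ccf).
  by apply: open_nbhs_nbhs; split=> //; exact: open_neq.
apply: filterS Ifnbhs => x /eqP Ifx.
(* If no arrow of [U] has range [x], then [f] is zero on the fibre over [x], and the rest of the
   groupoid is null for [nu x]. *)
apply: contrapT => nUx; apply: Ifx; apply/If0.
have mF : measurable (~` @gpd_fiber _ _ P act x : set (borel (gpd_unit act hP
  x))).
  by apply: borel_open; apply: closed_openC; exact: gpd_fiber_closed.
apply/eqP; rewrite -measure_le0 -(haar_system_fiberC x) le_measure ?inE//.
  by apply: borel_open; apply: open_comp => [d _|];
    [exact: Ccf.1|exact: open_neq].
by move=> d /= /fU Ud dx; apply: nUx; exists d.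
Qed.

End haar_system_open.

(** * From an open range map to an open action of the interior *)

Section act_open.
Context {G : topologicalGroupType} {X : topologicalType}.
Context {P : set G} {act : X -> G -> X}.
Hypotheses (X_hausdorff : hausdorff_space X) (X_compact : compact [set: X]).
Hypothesis hP : subsemigroup P.
Hypothesis PPV : forall g, exists a b, [/\ P a, P b & g = (a * b^-1)%g].
Hypotheses (hact : right_action P act) (injact : injective_action P act).
Local Open Scope group_scope.

(** This is continuity of the source map at [(x a, a^-1)], expressed by preimages under the action.
    Compactness of [X] reduces it to neighbourhoods of single points [z]: at [z = x] the set [W]
    itself serves, and for other [z] injectivity separates [z a] from [x a]. *)
Lemma act_preimage_near (x : X) (a : G) (W : set (X * G)) :
  P° a -> nbhs (x, a) W ->
  nbhs (act x a, a) [set p | forall z, act z p.2 = p.1 -> W (z, p.2)].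
Proof.
move=> Pa Wxa.
have /compact_near_coveringP cX := X_compact.
pose Q (p : X * G) z := act z p.2 = p.1 -> W (z, p.2).
suff cov z : [set: X] z ->
    \forall z' \near z & p \near nbhs (act x a, a), Q p z'.
  have H := cX _ (nbhs (act x a, a)) Q (nbhs_filter _) cov.
  by apply: (@filterS _ _ (nbhs_filter (act x a, a)) _ _ _ H) => p Hp z;
    exact: Hp.
move=> _.
have [->|zx] := eqVneq z x.
  have [[A B] [/= Ax Ba] AB] := Wxa.
  exists (A, [set p | B p.2]) => /=; last by move=> [z' p] [/= Az' Bp] _;
    exact: AB.
  by split=> //; exact: (@cvg_snd _ _ (nbhs (act x a)) (nbhs a)).
have zax : act z a != act x a.
  by apply: contraNN zx => /eqP/(injact (interior_subset Pa))/eqP.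
move: X_hausdorff; rewrite open_hausdorff =>
  /(_ _ _ zax)[[C D] /= [Cz Dx] [oC oD CD]].
have Cza : nbhs (act z a) C by apply: open_nbhs_nbhs; split=> //;
  exact: set_mem.
have Dxa : nbhs (act x a) D by apply: open_nbhs_nbhs; split=> //;
  exact: set_mem.
have [[A B] [/= Az Ba] AB] := act_continuous_at hact Pa Cza.
exists (A, [set p | D p.1 /\ B p.2]) => /=; last first.
  move=> [z' [y b]] [/= Az' [Dy Bb]] zy.
  have := AB (z', b) (conj Az' Bb); rewrite /= zy => Cy.
  by move/eqP: CD; rewrite -subset0 => /(_ y (conj Cy Dy)).
by split=> //; exists (D, B).
Qed.

(** All arrows close to [(x a, a^-1)] have the form [(z b, b^-1)] with [(z, b)] in [W]; their ranges
    [z b] fill a neighbourhood of [x a]. *)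
Lemma act_interior_open :
  (forall (c : groupoid P act) U, nbhs c U ->
    nbhs (gpd_rng c) (@gpd_rng _ _ P act @` U)) ->
  forall W : set (X * G), open W ->
    open [set act p.1 p.2 | p in W `&` [set: X] `*` P°].
Proof.
move=> rng_open W oW; rewrite openE => _ [[x a] [Wxa [_ /= Pa]] <-].
have Pa' := interior_subset Pa; have P1 := subsemigroup1 hP.
have xaG : semidirect P act (act x a, a^-1).
  by exists 1, a, x; split=> //=; rewrite ?mul1g// (act1 hact).
pose c : groupoid P act := 
  exist (fun p => p \in semidirect P act) _ (mem_set xaG).
pose V : set (X * G) := [set p | P° p.2 /\ forall z, act z p.2 = p.1 -> W (z,
  p.2)].
have Vxa : nbhs (act x a, a) V.
  apply: filterI; last by apply: act_preimage_near => //; exact: open_nbhs_nbhs.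
  exists ([set: X], P°) => [|p []//]; split=> /=; first exact: filterT.
  by apply: open_nbhs_nbhs; split=> //; exact: open_interior.
pose h (p : X * G) := (p.1, p.2^-1).
have ch : continuous h.
  move=> p; apply: cvg_pair; first exact: cvg_fst.
  apply: (@continuous_comp _ _ _ snd (fun g : G => g^-1)); first exact: cvg_snd.
  exact: invg_continuous.
have Uc : nbhs c ((h \o set_val) @^-1` V).
  apply: (@continuous_comp _ _ _ set_val h c).
  - exact: set_val_continuous.
  - exact: ch.
  by rewrite /h/= invgK.
apply: filterS (rng_open c _ Uc) => _ [d [/= Pd Wd] <-].
have [z zd] : exists z, act z (set_val d).2^-1 = gpd_rng d.
  have := set_mem (valP d); rewrite [\val d]surjective_pairing.
  have Pd' := interior_subset Pd.
  move=> /(semidirectE PPV hact injact _ Pd')[|z]; first by rewrite mulgV.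
  by rewrite mulgV (act1 hact) => dz; exists z; rewrite -dz.
by exists (z, (set_val d).2^-1) => //=; split=> //; apply: Wd.
Qed.

End act_open.

(** * Integrals for image measures and restricted measures *)

Section change_of_variables.
Context {R : realType} {d d' : measure_display}.
Context {S : measurableType d} {T : measurableType d'}.
Local Open Scope ereal_scope.

(* Unlike [integral_pushforward], no integrability is needed, since both sides
   are defined as the difference of the integrals of the positive and negative
   parts. *)
Lemma integral_pushforward_measurable (m : {measure set S -> \bar R}%R)
    (phi : S -> T) (mphi : measurable_fun setT phi) (D : set T) (f : T -> \bar
      R) :
  measurable D -> measurable_fun D f ->
  \int[pushforward m phi]_(y in D) f y = \int[m]_(x in phi @^-1` D) (f \o phi)
    x.
Proof.
move=> mD mf; rewrite [LHS]integralE [RHS]integralE.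
rewrite (ge0_integral_pushforward mphi m mD (measurable_funepos mf));
  last first.
  by move=> y _; exact: funepos_ge0.
rewrite (ge0_integral_pushforward mphi m mD (measurable_funeneg mf));
  last first.
  by move=> y _; exact: funeneg_ge0.
by rewrite -funepos_comp -funeneg_comp.
Qed.

(** For a nonnegative integrand the complement of [D] is discarded, being null for the restricted
    measure; positive and negative parts give the general case. *)
Lemma integral_mrestr (m : {measure set S -> \bar R}%R) (A D : set S)
    (mD : measurable D) (f : S -> \bar R) :
  measurable A -> measurable_fun A f ->
  \int[mrestr m mD]_(x in A) f x = \int[m]_(x in A `&` D) f x.
Proof.
move=> mA mf.
have ge0E g : measurable_fun A g -> (forall x, 0 <= g x) ->
    \int[mrestr m mD]_(x in A) g x = \int[m]_(x in A `&` D) g x.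
  move=> mg g_ge0.
  have D0 : mrestr m mD (~` D) = 0 by rewrite /mrestr setICl measure0.
  rewrite (ge0_negligible_integral (measurableC mD) mA mg (fun x _ =>
    g_ge0 x) D0).
  rewrite setDE setCK; apply: (eq_measure_integral m) => B mB BAD.
  by rewrite /= /mrestr; congr (m _); apply: setIidl => x /BAD[].
rewrite [LHS]integralE [RHS]integralE.
rewrite (ge0E _ (measurable_funepos mf)) ?(ge0E _ (measurable_funeneg mf))//.
Qed.

End change_of_variables.

(** * The measures [lambda^x]: support, regularity and invariance *)

Section fiber_haar_measure.
Context {R : realType} {G : topologicalGroupType} {X : topologicalType}.
Context {P : set G} {act : X -> G -> X}.
Variable mu : borel_measure R (1%g : G).
Hypotheses (G_hausdorff : hausdorff_space G) (G_countable : @second_countable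
  G).
Hypothesis G_lc : locally_compact [set: G].
Hypotheses (X_hausdorff : hausdorff_space X) (X_countable : @second_countable
  X).
Hypotheses (X_compact : compact [set: X]) (hP : subsemigroup P).
Hypothesis PPV : forall g, exists a b, [/\ P a, P b & g = (a * b^-1)%g].
Hypothesis P_interior : P `<=` closure (P°).
Hypotheses (hact : right_action P act) (injact : injective_action P act).
Hypothesis mu_haar : left_haar_measure mu.

Let gpd_hausdorff : hausdorff_space (groupoid P act).
Proof. exact: groupoid_hausdorff. Qed.

Local Notation Q := (gpd_Q P act).

Lemma gpd_Q_measurable (x : X) : measurable (Q x : set (borel (1%g : G))).
Proof. by apply: borel_closed; exact: gpd_Q_closed. Qed.

(** Off [Q x] the value is the unit at [x]; the measure pushed forward below is restricted to [Q x],
    so this default never contributes. *)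
Definition fiber_emb (x : X) (g : G) : groupoid P act :=
  insubd (gpd_unit act hP x) (x, g).

Lemma fiber_embE (x : X) (g : G) : Q x g -> set_val (fiber_emb x g) = (x, g).
Proof. by move=> Qxg; apply: insubdK; exact: mem_set. Qed.

Lemma gpd_Q_rng_snd (c : groupoid P act) : Q (gpd_rng c) (set_val c).2.
Proof. by have := set_mem (valP c); rewrite [\val c]surjective_pairing. Qed.

Lemma fiber_emb_rng_snd (c : groupoid P act) :
  fiber_emb (gpd_rng c) (set_val c).2 = c.
Proof.
apply: val_inj; rewrite [LHS]fiber_embE;
  first by rewrite [RHS]surjective_pairing.
exact: gpd_Q_rng_snd.
Qed.

(** Because of its default value, [fiber_emb x] need not be continuous on [G]; this form keeps its
    continuity along [Q x]. *)
Lemma fiber_emb_open (x : X) (U : set (groupoid P act)) : open U ->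
  exists2 V : set G, open V & forall g, Q x g -> U (fiber_emb x g) <-> V g.
Proof.
move=> [W oW <-]; exists ((fun g => (x, g)) @^-1` W).
  apply: open_comp => // g _; apply: cvg_pair; last exact: cvg_id.
  exact: cvg_cst.
by move=> g Qxg; rewrite /preimage/= fiber_embE.
Qed.

Lemma fiber_emb_measurable (x : X) :
  measurable_fun [set: borel (1%g : G)]
    (fiber_emb x : borel (1%g : G) -> borel (gpd_unit act hP x)).
Proof.
apply: borel_measurable_fun => U oU; have [V oV UV] := fiber_emb_open x oU.
have mQ := gpd_Q_measurable x.
(* Off [Q x] the map is constant, so the preimage contains all or nothing of the complement. *)
rewrite [X in measurable X](_ : _ = (Q x `&` V) `|`
    (~` Q x `&` [set g | U (gpd_unit act hP x)])).
  apply: measurableU; apply: measurableI => //; first exact: borel_open.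
    exact: measurableC.
  have [Ux|nUx] := pselect (U (gpd_unit act hP x)).
    by rewrite [X in measurable X](_ : _ = setT)//; apply/seteqP; split.
  by rewrite [X in measurable X](_ : _ = set0)//; apply/seteqP; split.
apply/seteqP; split=> g; rewrite /preimage/=.
  have [Qxg|nQxg] := pselect (Q x g); first by move=> /(UV g Qxg); left.
  rewrite /fiber_emb /insubd insubN/=; first by right.
  by apply/negP => /set_mem.
move=> [[Qxg Vg]|[nQxg Ux]]; first exact/UV.
by rewrite /fiber_emb /insubd insubN//; apply/negP => /set_mem.
Qed.

(* The instance is given explicitly because the measurability proof that it
  takes
   is not inferred. *)
Definition fiber_haar (x : X) : borel_measure R (gpd_unit act hP x) :=
  measure_function_pushforward__canonical__measure_function_Measure
    (mrestr mu (gpd_Q_measurable x)) (fiber_emb_measurable (x := x)).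

Lemma fiber_haarE (x : X) (A : set (groupoid P act)) :
  fiber_haar x A = mu (fiber_emb x @^-1` A `&` Q x).
Proof. by []. Qed.

Lemma fiber_haar_fiberC (x : X) : fiber_haar x (~` gpd_fiber x) = 0%E.
Proof.
rewrite fiber_haarE [X in mu X](_ : _ = set0) ?measure0//.
apply/seteqP; split=> // g [/= nF Qxg]; apply: nF.
by rewrite /gpd_fiber /preimage/= /gpd_rng fiber_embE.
Qed.

(** For [g] in [Q_x] the open set [g P°] lies in [Q_x] and has [g] in its closure. Every
    neighbourhood of the arrow [(x, g)] therefore contains the image of a nonempty open subset of
    [Q_x]. *)
Lemma fiber_haar_support (x : X) : measure_support (fiber_haar x) = gpd_fiber x.
Proof.
apply/seteqP; split=> c.
  apply: contraPP => nFc /(_ (~` gpd_fiber x)).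
  rewrite fiber_haar_fiberC ltxx => H.
  suff : open_nbhs c (~` gpd_fiber x) by move=> /H.
  by split=> //; apply: closed_openC; exact: gpd_fiber_closed.
move=> xc U [oU Uc]; have [V oV UV] := fiber_emb_open x oU.
have Qxc : Q x (set_val c).2 by rewrite -xc; exact: gpd_Q_rng_snd.
have Vc : V (set_val c).2 by apply/UV => //; rewrite -xc fiber_emb_rng_snd.
pose O := V `&` (fun h => (set_val c).2^-1 * h)%g @^-1` P°.
have oO : open O.
  by apply: openI => //; apply: open_preimage_mulgl; exact: open_interior.
have [p [Pp Vp]] : (P° `&` (fun h => (set_val c).2 * h)%g @^-1` V) !=set0.
  apply: (interior_closure1 hP P_interior); apply: open_nbhs_nbhs; split.
    exact: open_preimage_mulgl.
  by rewrite /preimage/= mulg1.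
have O0 : O !=set0.
  exists ((set_val c).2 * p)%g; split=> //.
  by rewrite /preimage/= mulgA mulVg mul1g.
have OU : O `<=` fiber_emb x @^-1` U `&` Q x.
  move=> h [Vh /interior_subset Ph].
  have Qxh : Q x h.
    by rewrite -[h]mul1g -(mulgV (set_val c).2) -mulgA; exact: gpd_Q_mulg.
  by split=> //; exact/UV.
rewrite fiber_haarE; apply: (lt_le_trans (haar_open_gt0 mu_haar G_hausdorff oO
  O0)).
apply: le_measure; rewrite ?inE//; first exact: borel_open.
apply: measurableI; last exact: gpd_Q_measurable.
rewrite -[X in measurable X]setTI; apply: (fiber_emb_measurable (x := x)) => //.
exact: borel_open.
Qed.

Lemma fiber_haar_radon (x : X) : radon (fiber_haar x).
Proof.
have mQ := gpd_Q_measurable x.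
have mpre (A : set (groupoid P act)) :
    measurable (A : set (borel (gpd_unit act hP x))) ->
    measurable (fiber_emb x @^-1` A `&` Q x : set (borel (1%g : G))).
  move=> mA; apply: measurableI => //.
  by rewrite -[X in measurable X]setTI; exact: (fiber_emb_measurable (x := x)).
split.
- move=> K cK; pose L := (fun c : groupoid P act => (set_val c).2) @` K.
  have cL : compact L.
    apply: continuous_compact => //; apply: continuous_subspaceT.
    exact: gpd_snd_continuous.
  have mL := borel_closed (t := 1%g) (compact_closed G_hausdorff cL).
  apply: le_lt_trans (radon_finite (haar_radon mu_haar) cL).
  rewrite fiber_haarE; apply: le_measure; rewrite ?inE//.
    by apply: mpre; apply: borel_closed; exact: compact_closed gpd_hausdorff cK.
  by move=> g [Kg Qxg]; exists (fiber_emb x g) => //; rewrite fiber_embE.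
- move=> A mA; apply/eqP; rewrite eq_le; apply/andP; split.
    apply: le_ereal_inf_tmp => _ [U [oU AU] <-].
    by apply: le_measure; rewrite ?inE//; exact: borel_open.
  rewrite fiber_haarE (radon_outer (haar_radon mu_haar) (mpre _ mA)).
  apply: le_ereal_inf_tmp => _ [V [oV AV] <-].
  (* Adding the null complement of the fibre makes [U] open and large enough to contain [A], at no
     cost in measure. *)
  pose U := ~` gpd_fiber x `|` (fun c : groupoid P act =>
    (set_val c).2) @^-1` V.
  have oU : open U.
    apply: openU; first by apply: closed_openC; exact: gpd_fiber_closed.
    by apply: open_comp => // c _; exact: gpd_snd_continuous.
  apply: (@le_trans _ _ (fiber_haar x U)).
    apply: ereal_inf_lbound; exists U => //; split=> // c Ac.
    have [xc|] := pselect (gpd_rng c = x); last by left.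
    right; apply: AV; split; last by rewrite -xc; exact: gpd_Q_rng_snd.
    by rewrite /preimage/= -xc fiber_emb_rng_snd.
  rewrite fiber_haarE; apply: le_measure; rewrite ?inE//.
  + by apply: mpre; exact: borel_open.
  + exact: borel_open.
  + move=> g [[nF|Vg] Qxg]; last by move: Vg; rewrite /preimage/= fiber_embE.
    by exfalso; apply: nF; rewrite /gpd_fiber /preimage/= /gpd_rng fiber_embE.
- move=> U oU; apply/eqP; rewrite eq_le; apply/andP; split; last first.
    apply: ge_ereal_sup => _ [K [cK KU] <-]; apply: le_measure; rewrite ?inE//.
      by apply: borel_closed; exact: compact_closed gpd_hausdorff cK.
    exact: borel_open.
  have [V oV UV] := fiber_emb_open x oU.
  (* The trace of [V] on [Q x] need not be open, so instead of inner regularity of [mu] an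
     exhaustion by compact sets and continuity from below are used. *)
  have [K [cK VK]] := open_sigma_compact G_lc G_hausdorff G_countable oV.
  pose L n := \big[setU/set0]_(i < n.+1) K i.
  have cL n : compact (L n) by apply: bigsetU_compact => i _; exact: cK.
  have mL n : measurable (L n `&` Q x : set (borel (1%g : G))).
    apply: measurableI => //; apply: borel_closed.
    exact: compact_closed G_hausdorff (cL n).
  have UL : fiber_emb x @^-1` U `&` Q x = \bigcup_n (L n `&` Q x).
    rewrite -setI_bigcupl; apply/seteqP; split=> g [Ug Qxg]; split=> //.
      have /UV := Ug; move=> /(_ Qxg); rewrite VK => -[n _ Kg].
      by exists n => //; rewrite /L big_ord_recr/=; right.
    apply/UV => //; have [n _] := Ug; rewrite /L -bigcup_mkord => -[i _ Kg].
    by rewrite VK; exists i.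
  have Lcvg : (mu \o (fun n => L n `&` Q x)) n @[n --> \oo] -->
      mu (\bigcup_n (L n `&` Q x)).
    apply: nondecreasing_cvg_mu => //; first exact: bigcupT_measurable.
    move=> n m nm; apply/subsetPset; apply: setSI.
    by apply: subset_bigsetU; rewrite ltnS.
  rewrite fiber_haarE UL -(cvg_lim _ Lcvg)//.
  apply: lime_le; first by apply/cvg_ex; exists (mu (\bigcup_n (L n `&` Q x))).
  apply: nearW => n /=.
  pose C : set (groupoid P act) := set_val @^-1` ([set x] `*` L n).
  have <- : fiber_haar x C = mu (L n `&` Q x).
    rewrite fiber_haarE; congr (mu _); apply/seteqP; split=> g [Lg Qxg];
      split=> //.
      by move: Lg; rewrite /C /preimage/= fiber_embE// => -[].
    by rewrite /C /preimage/= fiber_embE.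
  apply: ereal_sup_ubound; exists C => //; split.
    apply: compact_set_val_preimage; first exact: semidirect_closed.
    by apply: compact_setX; [exact: compact_set1|exact: cL].
  move=> c [/= xc Lc]; have xc' : gpd_rng c = x by [].
  rewrite -(fiber_emb_rng_snd c) xc'.
  apply/UV; first by rewrite -xc'; exact: gpd_Q_rng_snd.
  by move: Lc; rewrite VK /L -bigcup_mkord => -[i _ Kc]; exists i.
Qed.

Lemma fiber_haar_integral (x : X) (E : set (borel (gpd_unit act hP x)))
    (f : borel (gpd_unit act hP x) -> R) :
  measurable E -> measurable_fun setT f ->
  (\int[fiber_haar x]_(c in E) f c =
   \int[mu]_(g in fiber_emb x @^-1` E `&` Q x) f (fiber_emb x g))%R.
Proof.
move=> mE mf; congr fine.
have memb := fiber_emb_measurable (x := x).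
have mEf : measurable_fun setT (EFin \o f) by exact/measurable_EFinP.
have memb_f : measurable_fun [set: borel (1%g : G)]
    (EFin \o f \o (fiber_emb x : borel (1%g : G) -> borel (gpd_unit act hP x))).
  exact: measurableT_comp mEf memb.
rewrite (integral_pushforward_measurable (mrestr mu (gpd_Q_measurable x)) memb
  mE
  (measurable_funTS mEf)).
rewrite integral_mrestr//; last exact: measurable_funTS.
by rewrite -[X in measurable X]setTI; exact: memb.
Qed.

Lemma fiber_haar_integralT (x : X) (f : groupoid P act -> R) : continuous f ->
  (\int[fiber_haar x]_c f c = \int[mu]_(g in Q x) f (fiber_emb x g))%R.
Proof.
move=> cf; rewrite fiber_haar_integral ?preimage_setT ?setTI//.
exact: borel_continuous_measurable.
Qed.

Lemma haar_integral_mulgl (g : G) (D : set (borel (1%g : G)))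
    (f : borel (1%g : G) -> R) :
  measurable D -> measurable_fun setT f ->
  (\int[mu]_(h in D) f h =
   \int[mu]_(h in (fun h => g * h)%g @^-1` D) f (g * h)%g)%R.
Proof.
move=> mD mf; congr fine.
have mg := mulgl_measurable g.
have mEf : measurable_fun D (EFin \o f) by apply: measurable_funTS;
  exact/measurable_EFinP.
rewrite -[RHS](integral_pushforward_measurable mu mg mD mEf).
by apply: eq_measure_integral => A mA _;
  rewrite /= /pushforward haar_preimage_mulgl.
Qed.

(** For a denominator [d] suited to both [h] and [g * h], the fraction of [g * h * d] by [h * d]
    represents [g]. Hence both elements act to the same point, from the range and the source of [c]
    respectively, and the two tests of [semidirectE] coincide. *)
Lemma gpd_Q_mulgl (c : groupoid P act) (h : G) :
  Q (gpd_rng c) ((set_val c).2 * h)%g <-> Q (gpd_src c) h.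
Proof.
set g := (set_val c).2.
have [d1 Pd1 Phd1] := quotient_interior hP PPV P_interior h.
have [d2 Pd2 Pghd] := quotient_interior hP PPV P_interior (g * (h * d1))%g.
pose d := (d1 * d2)%g.
have Pd : P d by apply: (subsemigroupM hP); exact: interior_subset.
have Phd : P (h * d)%g.
  by rewrite /d mulgA; apply: (subsemigroupM hP); exact: interior_subset.
have Pghd' : P (g * h * d)%g.
  by rewrite /d -mulgA [(h * _)%g]mulgA mulgA; exact: interior_subset Pghd.
have E : act (gpd_rng c) (g * h * d)%g = act (gpd_src c) (h * d)%g.
  apply: (gpd_srcP hact injact PPV) => //.
  by rewrite -/g -[(g * h * d)%g]mulgA -mulgA mulgV mulg1.
have QE := semidirectE PPV hact injact.
split=> [/(QE _ _ _ Pd Pghd')|/(QE _ _ _ Pd Phd)] [y xy].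
  by apply/(QE _ _ _ Pd Phd); exists y; rewrite -E.
by apply/(QE _ _ _ Pd Pghd'); exists y; rewrite E.
Qed.

(** In the coordinates [fiber_emb], multiplication by [c] is left translation by [g] from [Q y] onto
    [Q x], so left invariance of [mu] applies. *)
Lemma fiber_haar_invariant (c : groupoid P act) (f : groupoid P act -> R) :
  continuous f ->
  (\int[fiber_haar (gpd_src c)]_(d in gpd_fiber (gpd_src c)) f (gpd_mul c d) =
   \int[fiber_haar (gpd_rng c)]_d f d)%R.
Proof.
move=> cf; set g := (set_val c).2; set x := gpd_rng c; set y := gpd_src c.
have mulE d : gpd_rng d = y -> gpd_mul c d = fiber_emb x (g * (set_val d).2)%g.
  move=> dy; apply: val_inj; rewrite [LHS](gpd_mulE hP hact injact PPV dy).
  rewrite [RHS]fiber_embE//; apply/gpd_Q_mulgl; rewrite -/y -dy.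
  exact: gpd_Q_rng_snd.
have mfemb : measurable_fun setT
    (fun h : borel (1%g : G) => f (fiber_emb x h)).
  apply: (@measurableT_comp _ _ _ _ _ _ (f : borel (gpd_unit act hP x) -> R)).
    exact: borel_continuous_measurable.
  exact: fiber_emb_measurable.
rewrite fiber_haar_integralT//.
rewrite (haar_integral_mulgl g (gpd_Q_measurable x) mfemb).
(* Off the fibre [gpd_mul c d] need not be a product of arrows. This integrand agrees with it on the
   fibre and is measurable everywhere. *)
have mprod : measurable_fun setT (fun d : borel (gpd_unit act hP y) =>
    f (fiber_emb x (g * (set_val (d : groupoid P act)).2)%g)).
  have mg : measurable_fun [set: borel (gpd_unit act hP y)]
      ((fun d => g * (set_val (d : groupoid P act)).2)%g :
        borel (gpd_unit act hP y) -> borel (1%g : G)).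
    apply: borel_measurable_fun => U oU; apply: borel_open.
    have oU' := open_preimage_mulgl g oU.
    have snd_cont : {in (fun d : groupoid P act => (set_val d).2) @^-1`
        ((fun h => g * h)%g @^-1` U),
        continuous (fun d : groupoid P act => (set_val d).2)}.
      by move=> d _; exact: gpd_snd_continuous.
    exact: open_comp snd_cont oU'.
  exact: measurableT_comp mfemb mg.
have mF : measurable (gpd_fiber y : set (borel (gpd_unit act hP y))).
  by apply: borel_closed; exact: gpd_fiber_closed.
transitivity (\int[fiber_haar y]_(d in gpd_fiber y)
    f (fiber_emb x (g * (set_val (d : groupoid P act)).2)%g))%R.
  by apply: eq_Rintegral => d /set_mem dy; rewrite mulE.
rewrite (fiber_haar_integral mF mprod).
have -> : fiber_emb y @^-1` gpd_fiber y `&` Q y = (fun h => g * h)%g @^-1` Q x.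
  apply/seteqP; split=> h; first by move=> [_ /gpd_Q_mulgl].
  move=> /gpd_Q_mulgl Qyh; split=> //.
  by rewrite /gpd_fiber /preimage/= /gpd_rng fiber_embE.
apply: eq_Rintegral => h /set_mem /gpd_Q_mulgl Qyh.
by rewrite fiber_embE.
Qed.



(** * Continuity of the measures [lambda^x] in [x] *)

Section continuity.
Hypothesis act_translate_open : forall a, P a ->
  open [set act (act x p) a | x in [set: X] & p in P°].

(** Condition (4) enters here. Testing [h] with denominator [p * b] shows that [x (h p b)] lies in
    the open set [X P° b]; so does [y (h p b)] for [y] near [x], which tests [h * p] with
    denominator [b]. *)
Lemma gpd_Q_near (x : X) (h p : G) : Q x h -> P° p ->
  \forall y \near x, Q y (h * p)%g.
Proof.
move=> Qxh Pp; have QE := semidirectE PPV hact injact.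
have [b Pb Phpb] := quotient_interior hP PPV P_interior (h * p)%g.
have [Pb' Phpb'] := (interior_subset Pb, interior_subset Phpb).
have Ppb : P (p * b)%g by apply: (subsemigroupM hP) => //;
  exact: interior_subset.
have Phpb2 : P (h * (p * b))%g by rewrite mulgA.
have /(QE _ _ _ Ppb Phpb2)[z xz] := Qxh.
have Sx : nbhs (act x (h * p * b)%g) [set act (act y q) b | y in [set: X] & q in
  P°].
  apply: open_nbhs_nbhs; split; first exact: act_translate_open.
  exists z => //; exists p => //; rewrite (actM hact) ?mulgA//.
    by rewrite -mulgA -xz mulgA.
  exact: interior_subset.
have Sx' : nbhs x ((act ^~ (h * p * b)%g) @^-1`
    [set act (act y q) b | y in [set: X] & q in P°]).
  exact: (act_continuous_l hact Phpb' Sx).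
apply: filterS Sx' => y [w _ [q Pq wq]].
by apply/(QE _ _ _ Pb' Phpb'); exists (act w q).
Qed.

Lemma gpd_Q_nnear (x : X) (g : G) : ~ Q x g -> \forall y \near x, ~ Q y g.
Proof.
move=> nQxg.
have oQ : open (~` semidirect P act) by apply: closed_openC;
  exact: semidirect_closed.
have [[A B] [/= Ax Bg] AB] : nbhs (x, g) (~` semidirect P act).
  exact: open_nbhs_nbhs.
by apply: filterS Ax => y Ay; apply: (AB (y, g)); split=> //;
  exact: nbhs_singleton.
Qed.

(** Extension by zero puts the integrals over all fibres on the single space [G], where dominated
    convergence can compare them. *)
Let fiber_restr (f : groupoid P act -> R) (y : X) : G -> R :=
  (fun g => f (fiber_emb y g)) \_ (Q y).

Lemma fiber_restr_cvg (f : groupoid P act -> R) (x : X) (g : G) : continuous f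
  ->
  ~ (Q x `\` [set h * p | h in Q x & p in P°]%g) g ->
  {for x, continuous (fun y => fiber_restr f y g)}.
Proof.
move=> cf; have [Qxg|nQxg _] := pselect (Q x g); last first.
  have Fx : fiber_restr f x g = 0%R by rewrite /fiber_restr patchN// notin_setE.
  move=> W; rewrite Fx => W0; apply: filterS (gpd_Q_nnear nQxg) => y nQyg.
  rewrite /= /fiber_restr patchN; last by rewrite notin_setE.
  exact: nbhs_singleton W0.
move=> nN; have [h Qxh [p Pp hpg]] : [set h * p | h in Q x & p in P°]%g g.
  by apply: contrapT => nQP; exact: nN.
have Qg : \forall y \near x, Q y g by rewrite -hpg; exact: gpd_Q_near.
have Fx : fiber_restr f x g = f (fiber_emb x g).
  by rewrite /fiber_restr patchT// mem_set.
move=> W; rewrite Fx => /cf[_ [[V oV <-] /= Vx VW]].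
rewrite fiber_embE// in Vx.
have [[A B] [/= Ax Bg] AB] : nbhs (x, g) V by exact: open_nbhs_nbhs.
apply: filterS (filterI Ax Qg) => y [Ay Qyg].
rewrite /= /fiber_restr patchT ?mem_set//; apply: VW;
  rewrite /preimage/= fiber_embE//.
by apply: AB; split=> //; exact: nbhs_singleton.
Qed.

Lemma fiber_haar_continuous (f : groupoid P act -> R) : Cc f ->
  continuous (fun x => \int[fiber_haar x]_c f c)%R.
Proof.
move=> Ccf; have [cf cK] := Ccf; have [M fM] := Cc_bounded Ccf.
have IE y : (\int[fiber_haar y]_c f c = \int[mu]_g fiber_restr f y g)%R.
  by rewrite fiber_haar_integralT// Rintegral_mkcond.
move=> x; under eq_fun do rewrite IE.
apply: (sequential_continuity_at X_countable) => u ux.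
have mF y :
    measurable_fun [set: borel (1%g : G)] (fun g => (fiber_restr f y g)%:E).
  apply/measurable_EFinP; apply/(measurable_restrictT _ (gpd_Q_measurable y)).
  apply: measurable_funTS.
  have memb := fiber_emb_measurable (x := y).
  exact: measurableT_comp (borel_continuous_measurable cf) memb.
pose K := (fun c : groupoid P act => (set_val c).2) @` closure [set c | f c !=
  0%R].
have cptK : compact K.
  apply: continuous_compact => //; apply: continuous_subspaceT.
  exact: gpd_snd_continuous.
have mK := borel_closed (t := 1%g) (compact_closed G_hausdorff cptK).
(* One compact set [K], the projection of the support of [f] to [G], serves all fibres. The absolute
   value of [M] makes the bound nonnegative, as needed off [Q y]. *)
pose D : borel (1%g : G) -> \bar R := (EFin \o cst `|M|%R) \_ K.
have intD : mu.-integrable setT D.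
  apply/(integrable_mkcond _ mK); apply: measurable_bounded_integrable => //.
    exact: radon_finite (haar_radon mu_haar) _ cptK.
  exists `|M|%R; split; first exact: num_real.
  by move=> N /ltW MN g _ /=; rewrite normr_id.
have FD y g : (`|(fiber_restr f y g)%:E| <= D g)%E.
  have [Kg|nKg] := pselect (K g).
    rewrite /D patchT ?mem_set//= lee_fin /fiber_restr /patch.
    by case: ifP => _; [exact: le_trans (fM _) (ler_norm _)|rewrite normr0].
  have F0 : fiber_restr f y g = 0%R.
    rewrite /fiber_restr /patch; case: ifPn => // /set_mem Qyg.
    apply/eqP; apply: contra_notT nKg => fyg; exists (fiber_emb y g).
      exact: subset_closure.
    by rewrite fiber_embE.
  by rewrite F0 /= normr0 /D patchN// notin_setE.
have aecvg : {ae mu, forall g, setT g ->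
    (fiber_restr f (u n) g)%:E @[n --> \oo] --> (fiber_restr f x g)%:E}.
  pose N := Q x `\` [set h * p | h in Q x & p in P°]%g.
  have oQP : open [set h * p | h in Q x & p in P°]%g.
    by apply: open_mulg_set; exact: open_interior.
  exists N; split.
  - by apply: measurableD; [exact: gpd_Q_measurable|exact: borel_open].
  - apply: haar_null_boundary => //.
    + exact: gpd_Q_closed.
    + exact: open_interior.
    + exact: interior_closure1 hP P_interior.
  - move=> g /= ncvg; apply: contrapT => nNg; apply: ncvg => _.
    apply: cvg_EFin; first exact: nearW.
    exact: cvg_comp ux (fiber_restr_cvg cf nNg).
have aeD : {ae mu, forall g n, setT g -> `|(fiber_restr f (u n) g)%:E| <= D
  g}%E.
  by apply: aeW => g n _; exact: FD.
have [intF _ cvgF] :=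
  dominated_convergence measurableT (fun n => mF (u n)) (mF x) aecvg intD aeD.
apply: fine_cvg; rewrite /Rintegral fineK; first exact: cvgF.
exact: integrable_fin_num.
Qed.

End continuity.

End fiber_haar_measure.

(** * The cycle of implications between the five conditions *)

Theorem theorem4p3 (R : realType) (G : topologicalGroupType)
    (X : topologicalType) (P : set G) (act : X -> G -> X)
    (mu : borel_measure R (1%g : G))
    (G_hausdorff : hausdorff_space G) (G_countable : @second_countable G)
    (G_lc : locally_compact [set: G])
    (X_hausdorff : hausdorff_space X) (X_countable : @second_countable X)
    (X_compact : compact [set: X])
    (P_closed : closed P) (hP : subsemigroup P)
    (PPV : forall g, exists a b, [/\ P a, P b & g = (a * b^-1)%g])
    (P_interior : P `<=` closure (P°))
    (hact : right_action P act) (injact : injective_action P act)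
    (mu_haar : left_haar_measure mu) :
  [<-> (exists nu : forall x, borel_measure R (gpd_unit act hP x),
          left_haar_system nu) ;
       (forall W : set (X * G), open W ->
          open [set act p.1 p.2 | p in W `&` [set: X] `*` P°]) ;
       (forall U : set G, open U -> U `<=` P° ->
          open [set act x u | x in [set: X] & u in U]) ;
       (forall a, P a ->
          open [set act (act x p) a | x in [set: X] & p in P°]) ;
       (exists lambda : forall x, borel_measure R (gpd_unit act hP x),
          (forall x, is_lambda mu (lambda x)) /\ left_haar_system lambda) ].
Proof.
tfae.
- move=> [nu nu_haar]; apply: (act_interior_open X_hausdorff X_compact hP PPV
    hact injact).
  exact: (haar_system_range_open G_hausdorff G_lc X_hausdorff X_compact PPV
    P_interior hact injact nu_haar).
- move=> act_open U oU UP.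
  have oXU : open (@snd X G @^-1` U) by apply: open_comp => // p _;
    exact: cvg_snd.
  have := act_open _ oXU; congr open.
  apply/seteqP; split=> [_ [[x u] [/= Uu _] <-]|_ [x _ [u Uu <-]]].
    by exists x => //; exists u.
  by exists (x, u) => //; split=> //; split=> //; exact: UP.
(* Condition (3) is applied to [P° a], the preimage of [P°] under right translation by [a^-1]; it is
   open, and contained in [P°] by [interior_mulgr]. *)
- move=> act_open a Pa.
  have := act_open _ (open_preimage_mulgr a^-1%g (open_interior P)).
  have UP : (fun h => h * a^-1)%g @^-1` P° `<=` P°.
    move=> h /(interior_mulgr hP Pa).
    by rewrite -mulgA mulVg mulg1.
  move=> /(_ UP); congr open; apply/seteqP;
    split=> [_ [x _ [u Uu <-]]|_ [x _ [p Pp <-]]].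
    exists x => //; exists (u * a^-1)%g => //.
    by rewrite (actM hact) ?mulgVK -?mulgA ?mulVg ?mulg1//;
      exact: interior_subset Uu.
  exists x => //; exists (p * a)%g; first by rewrite /preimage/= -mulgA mulgV
    mulg1.
  by rewrite (actM hact)//; exact: interior_subset Pp.
- move=> act_open.
  pose lambda :=
    fiber_haar mu X_hausdorff X_compact hP PPV P_interior hact injact.
  have lambda_radon x : radon (lambda x).
    exact: (fiber_haar_radon G_hausdorff G_countable G_lc X_hausdorff X_compact
      hP PPV P_interior hact injact mu_haar).
  exists lambda; split=> [x|].
    split=> [|f [cf _]]; first exact: lambda_radon.
    exact: (fiber_haar_integralT mu X_hausdorff X_compact hP PPV P_interior
      hact injact x cf).
  split=> [x|x|f Ccf|c f [cf _]].
  + exact: lambda_radon.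
  + exact: (fiber_haar_support G_hausdorff X_hausdorff X_compact hP PPV
      P_interior hact injact mu_haar).
  + exact: (fiber_haar_continuous G_hausdorff G_countable G_lc X_countable
      mu_haar act_open Ccf).
  + exact: (fiber_haar_invariant X_hausdorff X_compact hP PPV P_interior
      hact injact mu_haar c cf).
- by move=> [lambda [_ lambda_haar]]; exists lambda.
Qed.
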